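(* For every $R>0$ there is a constant $C_R>0$ such that for any $(p_1,p_2)\in\mathbb{R}^d\times B_R(0)$ it holds that $$\eta(p_1|p_2)\ge\frac{C_R\,|p_1-p_2|^2}{1+|p_1-p_2|}.$$ In particular, $\eta(p_1|p_2)\ge0$ for all $p_1,p_2\in\mathbb{R}^d$.
   Context: Here $d\ge2$, $B_R(0)$ is the ball of radius $R$ centered at the origin in $\mathbb{R}^d$, $\mathscr{K}(p)=\sqrt{1+|p|^2}$ for $p\in\mathbb{R}^d$, and $$\eta(p_1|p_2)=\mathscr{K}(p_1)-\mathscr{K}(p_2)-\nabla\mathscr{K}(p_2)\cdot(p_1-p_2).$$ *)

(* Defs.v *)
From mathcomp Require Import all_boot all_order all_algebra.
From mathcomp Require Import all_classical all_reals all_analysis.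
Set Implicit Arguments.
Unset Strict Implicit.
Unset Printing Implicit Defensive.
Import Order.TTheory GRing.Theory Num.Theory.
Import numFieldNormedType.Exports.
Local Open Scope classical_set_scope.
Local Open Scope ring_scope.

Section RelativisticEnergy.
Context {R : realType} {d : nat}.
Implicit Types (p q : 'rV[R]_d).

Definition dotp p q : R := \sum_(i < d) p ord0 i * q ord0 i.

(* The library's `|p| on 'rV[R]_d is the sup norm, and [ball] is the
   corresponding cube; the Euclidean versions are needed here. *)
Definition enorm p : R := Num.sqrt (dotp p p).

Definition eball p (r : R) : set 'rV[R]_d := [set q | enorm (q - p) < r].

Definition gradient (f : 'rV[R]_d -> R) p : 'rV[R]_d :=
  \row_(i < d) 'D_('e_i) f p.

Definition kinetic p : R := Num.sqrt (1 + enorm p ^+ 2).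

Definition eta p1 p2 : R :=
  kinetic p1 - kinetic p2 - dotp (gradient kinetic p2) (p1 - p2).

End RelativisticEnergy.

(* Main.v *)
Require Import Defs.
From mathcomp Require Import all_boot all_order all_algebra.
From mathcomp Require Import all_classical all_reals all_analysis.
From mathcomp Require Import ring lra.
Import Order.TTheory GRing.Theory Num.Theory.
Import numFieldNormedType.Exports.
Local Open Scope classical_set_scope.
Local Open Scope ring_scope.

(** Write [a], [b] for the kinetic energies of [p1], [p2] and [c = 1 + p1.p2].
    Since the gradient of the kinetic energy at [p2] is [p2 / b], one finds
    [b * eta p1 p2 = a * b - c].  Cauchy-Schwarz gives
    [(a * b - c) * (a * b + c) >= |p1 - p2|^2] and [|c| <= a * b], hence
    [2 * a * b^2 * eta p1 p2 >= |p1 - p2|^2].  Finally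
    [a <= b + |p1 - p2| <= b * (1 + |p1 - p2|)] and [b <= 1 + r] on the ball of
    radius [r], so that the constant [1 / (2 * (1 + r)^3)] works. *)

Section EuclideanProduct.
Context {R : realType} {d : nat}.
Implicit Types (p q v : 'rV[R]_d) (a : R).

Lemma dotpC p q : dotp p q = dotp q p.
Proof. by apply: eq_bigr => i _; rewrite mulrC. Qed.

Lemma dotpDl p q v : dotp (p + q) v = dotp p v + dotp q v.
Proof. by rewrite -big_split; apply: eq_bigr => i _; rewrite mxE mulrDl. Qed.

Lemma dotpDr p q v : dotp v (p + q) = dotp v p + dotp v q.
Proof. by rewrite !(dotpC v) dotpDl. Qed.

Lemma dotpZl a p q : dotp (a *: p) q = a * dotp p q.
Proof. by rewrite mulr_sumr; apply: eq_bigr => i _; rewrite mxE mulrA. Qed.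

Lemma dotpZr a p q : dotp p (a *: q) = a * dotp p q.
Proof. by rewrite !(dotpC p) dotpZl. Qed.

Lemma dotpBl p q v : dotp (p - q) v = dotp p v - dotp q v.
Proof. by rewrite dotpDl -scaleN1r dotpZl mulN1r. Qed.

Lemma dotpBr p q v : dotp v (p - q) = dotp v p - dotp v q.
Proof. by rewrite !(dotpC v) dotpBl. Qed.

Lemma dotp_delta p (i : 'I_d) : dotp p 'e_i = p ord0 i.
Proof.
rewrite /dotp (bigD1 i) //= big1 => [|j ji]; last first.
  by rewrite mxE eqxx (negbTE ji) mulr0.
by rewrite mxE !eqxx mulr1 addr0.
Qed.

Lemma dotp_ge0 p : 0 <= dotp p p.
Proof. by apply: sumr_ge0 => i _; rewrite -expr2 sqr_ge0. Qed.

Lemma dotp_eq0 p : dotp p p = 0 -> p = 0.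
Proof.
move=> /eqP; rewrite psumr_eq0 => [/allP p0|i _]; last by rewrite -expr2 sqr_ge0.
apply/rowP => i; have := p0 i; rewrite mem_index_enum mxE => /(_ isT).
by rewrite -expr2 sqrf_eq0 => /eqP.
Qed.

(** For [q] nonzero, the squared length of [|q|^2 p - (p.q) q] expands to
    [|q|^2 (|p|^2 |q|^2 - (p.q)^2)], and the positive factor [|q|^2] can be cancelled. *)
Lemma CauchySchwarz_dotp p q : dotp p q ^+ 2 <= dotp p p * dotp q q.
Proof.
have := dotp_ge0 q; rewrite le_eqVlt => /predU1P[/esym q0|q_gt0].
  by rewrite q0 (dotp_eq0 _ q0) -(scale0r 0) dotpZr mul0r expr0n mulr0.
have := dotp_ge0 (dotp q q *: p - dotp p q *: q).
rewrite !(dotpBl, dotpBr, dotpZl, dotpZr) (dotpC q p) => H.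
rewrite -subr_ge0 -(pmulr_rge0 _ q_gt0); apply: le_trans H _.
by rewrite le_eqVlt; apply/orP; left; apply/eqP; ring.
Qed.

Lemma enorm_ge0 p : 0 <= enorm p.
Proof. exact: sqrtr_ge0. Qed.

Lemma sqr_enorm p : enorm p ^+ 2 = dotp p p.
Proof. by rewrite sqr_sqrtr ?dotp_ge0. Qed.

Lemma dotp_le_enorm p q : dotp p q <= enorm p * enorm q.
Proof.
apply: le_trans (ler_norm _) _.
rewrite -(@ler_pXn2r _ 2) ?nnegrE ?mulr_ge0 ?enorm_ge0 //.
by rewrite real_normK ?num_real // exprMn !sqr_enorm CauchySchwarz_dotp.
Qed.

End EuclideanProduct.

Section KineticEnergy.
Context {R : realType} {d : nat}.
Implicit Types (p q v : 'rV[R]_d).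

Lemma sqr_kinetic p : kinetic p ^+ 2 = 1 + dotp p p.
Proof. by rewrite sqr_sqrtr sqr_enorm // addr_ge0 ?dotp_ge0. Qed.

Lemma kinetic_ge1 p : 1 <= kinetic p.
Proof.
rewrite -(@ler_pXn2r _ 2) ?nnegrE ?sqrtr_ge0 //.
by rewrite sqr_kinetic expr1n lerDl dotp_ge0.
Qed.

Lemma kinetic_gt0 p : 0 < kinetic p.
Proof. exact: lt_le_trans ltr01 (kinetic_ge1 p). Qed.

Lemma kinetic_le_enorm p : kinetic p <= 1 + enorm p.
Proof.
rewrite -(@ler_pXn2r _ 2) ?nnegrE ?addr_ge0 ?sqrtr_ge0 //.
by rewrite sqr_kinetic -sqr_enorm; have := enorm_ge0 p; nra.
Qed.

Lemma enorm_le_kinetic p : enorm p <= kinetic p.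
Proof.
rewrite -(@ler_pXn2r _ 2) ?nnegrE ?sqrtr_ge0 //.
by rewrite sqr_kinetic sqr_enorm lerDr.
Qed.

(** After squaring, only the cross terms matter: [q.(p - q) <= |q| |p - q|], and [|q|] is at most
    [kinetic q]. *)
Lemma kinetic_le_dist p q : kinetic p <= kinetic q + enorm (p - q).
Proof.
rewrite -(@ler_pXn2r _ 2) ?nnegrE ?addr_ge0 ?sqrtr_ge0 //.
have cs : dotp q (p - q) <= kinetic q * enorm (p - q).
  apply: le_trans (dotp_le_enorm _ _) _.
  by rewrite ler_wpM2r ?enorm_ge0 ?enorm_le_kinetic.
rewrite sqrrD !sqr_kinetic sqr_enorm.
move: cs; rewrite !(dotpBl, dotpBr) (dotpC q p) => cs.
lra.
Qed.

(** On the line [t *: v + p] the squared energy is a quadratic polynomial [g] in [t] with [g 0 > 0],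
    so the one-variable chain rule for [Num.sqrt \o g] at 0 applies. *)
Lemma derive_kinetic p v : 'D_v kinetic p = dotp p v / kinetic p.
Proof.
pose g (t : R) := 1 + dotp p p + t * (2 * dotp p v) + t ^+ 2 * dotp v v.
have kg t : kinetic (t *: v + p) = Num.sqrt (g t).
  rewrite /kinetic sqr_enorm /g; congr Num.sqrt.
  by rewrite !(dotpDl, dotpDr, dotpZl, dotpZr) (dotpC v p); ring.
have k0 : kinetic p = Num.sqrt (g 0) by rewrite -kg scale0r add0r.
have dg : is_derive (0 : R) 1 g (2 * dotp p v).
  rewrite /g; apply: is_derive_eq.
  by rewrite /GRing.scale /=; ring.
have g0 : 0 < g 0 by rewrite -sqrtr_gt0 -k0 kinetic_gt0.
have dsg := is_derive1_comp (is_derive1_sqrt g0) dg.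
transitivity ('D_1 (Num.sqrt \o g) (0 : R)); last first.
  rewrite (@derive_val _ _ _ _ _ _ _ dsg) -k0.
  by have := kinetic_gt0 p => ?; field; lra.
(* The two derivatives are limits of the same difference quotient. *)
rewrite /derive; congr (lim (_ @ 0^')); apply/funext => h /=.
by rewrite kg k0 addr0 /GRing.scale /= mulr1.
Qed.

Lemma gradient_kinetic p : gradient kinetic p = (kinetic p)^-1 *: p.
Proof.
by apply/rowP => i; rewrite !mxE derive_kinetic dotp_delta mulrC.
Qed.

Lemma etaE p1 p2 :
  eta p1 p2 = (kinetic p1 * kinetic p2 - (1 + dotp p1 p2)) / kinetic p2.
Proof.
have b0 := kinetic_gt0 p2; have b2 := sqr_kinetic p2.
rewrite /eta gradient_kinetic dotpZl dotpBr (dotpC p2 p1).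
(* Over the denominator [kinetic p2], this substitution cancels the square of [kinetic p2] and
   leaves the 1 of [1 + dotp p1 p2]. *)
have -> : dotp p2 p2 = kinetic p2 ^+ 2 - 1 by rewrite b2 addrC addKr.
by field; lra.
Qed.

Lemma sqr_enorm_le_eta p1 p2 :
  enorm (p1 - p2) ^+ 2 <= 2 * kinetic p1 * kinetic p2 ^+ 2 * eta p1 p2.
Proof.
have a0 := kinetic_gt0 p1; have b0 := kinetic_gt0 p2.
set a := kinetic p1 in a0 *; set b := kinetic p2 in b0 *.
pose c := 1 + dotp p1 p2.
have -> : 2 * a * b ^+ 2 * eta p1 p2 = (a * b - c) * (2 * (a * b)).
  by rewrite etaE -/a -/b -/c; field; lra.
have ab0 : 0 < a * b by exact: mulr_gt0.
(* The right side minus the left is exactly the Cauchy-Schwarz defect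
   [|p1|^2 |p2|^2 - (p1.p2)^2]. *)
have key : enorm (p1 - p2) ^+ 2 <= (a * b - c) * (a * b + c).
  rewrite -subr_sqr exprMn !sqr_kinetic sqr_enorm /c.
  rewrite !(dotpBl, dotpBr) (dotpC p2 p1).
  by have := CauchySchwarz_dotp p1 p2; nra.
(* If [c > a * b > 0], the product in [key] would be negative while bounding a square. This bound
   also gives [a * b + c <= 2 * (a * b)]. *)
have c_le : c <= a * b.
  rewrite leNgt; apply/negP => ab_lt.
  have : 0 < (c - a * b) * (a * b + c) by rewrite mulr_gt0 ?subr_gt0 //; lra.
  by have := le_trans (sqr_ge0 _) key; lra.
apply: le_trans key _.
by rewrite ler_wpM2l ?subr_ge0 //; lra.
Qed.

Lemma eta_ge0 p1 p2 : 0 <= eta p1 p2.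
Proof.
have := le_trans (sqr_ge0 _) (sqr_enorm_le_eta p1 p2).
by rewrite pmulr_rge0 // !mulr_gt0 ?exprn_gt0 ?kinetic_gt0.
Qed.

End KineticEnergy.

Theorem lemma2p3 (R : realType) (d : nat) (hd : (2 <= d)%N) :
  (forall r : R, 0 < r ->
     exists2 C : R, 0 < C &
       forall p1 p2 : 'rV[R]_d, p2 \in eball 0 r ->
         C * enorm (p1 - p2) ^+ 2 / (1 + enorm (p1 - p2)) <= eta p1 p2)
  /\ (forall p1 p2 : 'rV[R]_d, 0 <= eta p1 p2).
Proof.
split=> [r r0|]; last exact: eta_ge0.
have r1 : 0 < 1 + r by lra.
(* One factor [1 + r] pays for [kinetic p1], the other two for [kinetic p2 ^+ 2]. *)
exists (2 * (1 + r) ^+ 3)^-1; first by rewrite invr_gt0 mulr_gt0 ?exprn_gt0.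
move=> p1 p2; rewrite inE /eball /= subr0 => p2r.
set n := enorm (p1 - p2).
have n0 : 0 <= n := enorm_ge0 _.
have n1 : 0 < 1 + n by lra.
have b1 := kinetic_ge1 p2; have b0 := kinetic_gt0 p2.
have br : kinetic p2 <= 1 + r by have := kinetic_le_enorm p2; lra.
have a_le : kinetic p1 <= (1 + r) * (1 + n).
  by have := kinetic_le_dist p1 p2; rewrite -/n; nra.
rewrite ler_pdivrMr // ler_pdivrMl ?mulr_gt0 ?exprn_gt0 //.
apply: le_trans (sqr_enorm_le_eta p1 p2) _.
(* Both sides carry the nonnegative factor [eta p1 p2], so only its coefficients remain to be
   compared. *)
rewrite [eta p1 p2 * _]mulrC [leRHS]mulrA ler_wpM2r ?eta_ge0 //.
rewrite -[leLHS]mulrA.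
have -> : 2 * (1 + r) ^+ 3 * (1 + n) = 2 * ((1 + r) * (1 + n) * (1 + r) ^+ 2).
  by ring.
rewrite ler_wpM2l //.
apply: ler_pM => //; [exact: ltW (kinetic_gt0 p1)|exact: sqr_ge0|].
by rewrite ler_pXn2r // nnegrE ltW.
Qed.
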